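(* Let $\lambda=2^{5/2}$ and consider the linear system $$\frac{d b_j}{dt}=\lambda^{\frac{2j}{3}}\big(2\lambda^{-\frac23}b_{j-1}-\lambda^{-\frac13}b_j-b_{j+1}\big)\quad (j>0),\qquad \frac{d b_0}{dt}=-\lambda^{-\frac13}b_0-b_1.$$ There are no positive eigenvalues of this system. Moreover, there exist nonzero solutions of this system of the form $b_j(t)=c_je^{\mu t}$ ($j\ge 0$) with $\mu$ real and negative, belonging to $H^s$ for every $s<5/6$.
   Context: Sequences are real and indexed by $j=0,1,2,\dots$. $l^2$ is the space of sequences with $\|a\|_{l^2}=\big(\sum_{j\ge0}a_j^2\big)^{1/2}<\infty$, and $H^s$ is the space of sequences with $\|a\|_{H^s}=\big(\sum_{j\ge 0}2^{2sj}a_j^2\big)^{1/2}<\infty$. A real number $\mu$ is called an eigenvalue of the linear system if there is a nonzero sequence $c=\{c_j\}_{j\ge 0}\in l^2$ such that $b_j(t)=c_je^{\mu t}$ solves the system, that is, $\mu c_j=\lambda^{2j/3}(2\lambda^{-2/3}c_{j-1}-\lambda^{-1/3}c_j-c_{j+1})$ for all $j>0$ and $\mu c_0=-\lambda^{-1/3}c_0-c_1$. A solution $b_j(t)=c_je^{\mu t}$ belongs to $H^s$ if $\{c_j\}\in H^s$. (The linear system is the linearization of $\frac{da_j}{dt}=\lambda^{j-1}a_{j-1}^2-\lambda^ja_ja_{j+1}$ for $j>0$, $\frac{da_0}{dt}=-a_0a_1+\lambda^{-1/3}$, about its fixed point $a_j=\lambda^{-j/3}$.) *)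

(* Defs.v *)
From Stdlib Require Import Reals.
From Coquelicot Require Import Coquelicot.
Open Scope R_scope.

(** Right-hand side of the linear system; [lam] is the shell spacing lambda.
    All real powers are [Rpower], which is the usual power for [lam > 0]. *)
Definition lin_rhs (lam : R) (b : nat -> R) (j : nat) : R :=
  match j with
  | O => - Rpower lam (-1/3) * b 0%nat - b 1%nat
  | S i =>
      Rpower lam (2 * INR j / 3) *
        (2 * Rpower lam (-2/3) * b i - Rpower lam (-1/3) * b j - b (S j))
  end.

(** The time variable comes second: [b j t] is b_j(t). *)
Definition solves_lin (lam : R) (b : nat -> R -> R) : Prop :=
  forall (j : nat) (t : R), is_derive (b j) t (lin_rhs lam (fun i => b i t) j).

Definition exp_mode (c : nat -> R) (mu : R) (j : nat) (t : R) : R :=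
  c j * exp (mu * t).

Definition nonzero_seq (c : nat -> R) : Prop := exists j, c j <> 0.

(** The terms are nonnegative, so convergence of the series is finiteness of
    the norm. *)
Definition in_l2 (a : nat -> R) : Prop := ex_series (fun j => a j ^ 2).

Definition in_Hs (s : R) (a : nat -> R) : Prop :=
  ex_series (fun j => Rpower 2 (2 * s * INR j) * a j ^ 2).

Definition eigenvalue (lam mu : R) : Prop :=
  exists c : nat -> R,
    nonzero_seq c /\ in_l2 c /\ solves_lin lam (exp_mode c mu).

(* Main.v *)
Require Import Defs.
From Stdlib Require Import Reals Lra.
From Coquelicot Require Import Coquelicot.
Open Scope R_scope.

(** Put [p = lam^(1/3)], [q = p^-2], [mu = -k/p] and [c_j = (-1/p)^j e_j].  The
    eigenvalue equation becomes [e_(j+1) = 2 e_(j-1) + (1 - k q^j) e_j], whose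
    solutions generically grow like [2^j], the exceptional ones behaving like
    [(-1)^j].  For [k < 0] all [e_j] are positive and [e_j >= 2^j/2], so [c] does
    not tend to [0] because [p < 2].  For [0 <= k <= 1/q] the coefficients
    [1 - k q^j] ([j >= 1]) are nonnegative, so two consecutive terms of the same
    sign fix the sign of all later terms.  The sets of [k] for which the final sign
    is [+] and [-] are open and disjoint; they contain [0] and [1/q] respectively, so
    some [k] strictly between lies in neither.  For it [e] alternates in sign
    forever, [|e_(j+1) - 2 e_j| = |e_(j+1)| + 2 |e_j|] is multiplied by at most
    [1 + k q^(j+1)] at each step, and [e] is bounded. *)

(** * The recurrence and its growth for nonpositive [k] *)

Fixpoint profile (q k : R) (j : nat) : R :=
  match j with
  | O => 1
  | S i => match i with
           | O => 1 - k
           | S h => 2 * profile q k h + (1 - k * q ^ i) * profile q k i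
           end
  end.

Lemma profile_SS (q k : R) (j : nat) :
  profile q k (S (S j)) =
  2 * profile q k j + (1 - k * q ^ S j) * profile q k (S j).
Proof. reflexivity. Qed.

Lemma pair_induction (P : nat -> Prop) :
  P 0%nat -> P 1%nat -> (forall j, P j -> P (S j) -> P (S (S j))) ->
  forall j, P j.
Proof.
  intros H0 H1 HS j.
  enough (P j /\ P (S j)) by tauto.
  induction j as [|j [IH1 IH2]]; auto.
Qed.

Lemma profile_unique (q k : R) (e : nat -> R) :
  e 1%nat = (1 - k) * e 0%nat ->
  (forall j, e (S (S j)) = 2 * e j + (1 - k * q ^ S j) * e (S j)) ->
  forall j, e j = e 0%nat * profile q k j.
Proof.
  intros H1 HS; apply pair_induction.
  - simpl; ring.
  - rewrite H1; simpl; ring.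
  - intros j IH0 IH1; rewrite HS, profile_SS, IH0, IH1; ring.
Qed.

(** Dropping the nonnegative term [- k q^(j+1) e_(j+1)] leaves [e_(j+2) >= 2 e_j + e_(j+1)], which
    [2^j / 2] satisfies with equality. *)
Lemma profile_lower_bound (q k : R) (hq : 0 < q) (hk : k <= 0) (j : nat) :
  2 ^ j / 2 <= profile q k j.
Proof.
  revert j; apply pair_induction.
  - simpl; lra.
  - simpl; lra.
  - intros j IH0 IH1; rewrite profile_SS.
    assert (Hq := pow_lt q (S j) hq).
    assert (H2 : 0 < 2 ^ j) by (apply pow_lt; lra).
    change (2 ^ S j) with (2 * 2 ^ j) in IH1.
    change (2 ^ S (S j)) with (2 * (2 * 2 ^ j)).
    assert (0 <= - k * q ^ S j * profile q k (S j))
      by (apply Rmult_le_pos; [apply Rmult_le_pos |]; lra).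
    lra.
Qed.

(** * Final signs and the choice of [k] *)

(** Testing a single pair, not a whole tail, makes this an open condition on [k]; [sg] is 1 or
    -1. *)
Definition settles (sg q k : R) : Prop :=
  exists j, 0 < sg * profile q k (S j) /\ 0 < sg * profile q k (S (S j)).

Lemma coeff_nonneg (q k : R) (j : nat) :
  0 < q <= 1 -> 0 <= k -> k * q <= 1 -> 0 <= 1 - k * q ^ S j.
Proof.
  intros Hq Hk Hkq.
  assert (Hj : q ^ j <= 1 ^ j) by (apply pow_incr; lra).
  assert (Hj0 : 0 < q ^ j) by (apply pow_lt; lra).
  rewrite pow1 in Hj; simpl.
  nra.
Qed.

Lemma same_sign_persists (sg q k : R) (j n : nat) :
  0 < q <= 1 -> 0 <= k -> k * q <= 1 ->
  0 < sg * profile q k (S j) -> 0 < sg * profile q k (S (S j)) ->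
  0 < sg * profile q k (S (n + j)).
Proof.
  intros Hq Hk Hkq H0 H1; revert n; apply pair_induction; [exact H0 | exact H1 |].
  intros n IH0 IH1; change (S (S (S n) + j)) with (S (S (S (n + j)))).
  change (S (S n + j)) with (S (S (n + j))) in IH1.
  rewrite profile_SS.
  assert (Hc := coeff_nonneg q k (S (n + j)) Hq Hk Hkq).
  nra.
Qed.

Lemma settles_disjoint (q k : R) :
  0 < q <= 1 -> 0 <= k -> k * q <= 1 -> settles 1 q k -> ~ settles (-1) q k.
Proof.
  intros Hq Hk Hkq [i [Hi0 Hi1]] [j [Hj0 Hj1]].
  (* Both signs are propagated to the common index [S (i + j)]. *)
  assert (A := same_sign_persists _ q k i j Hq Hk Hkq Hi0 Hi1).
  assert (B := same_sign_persists _ q k j i Hq Hk Hkq Hj0 Hj1).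
  rewrite Nat.add_comm in B; lra.
Qed.

Lemma continuous_profile (q : R) (j : nat) (k : R) :
  continuous (fun k => profile q k j) k.
Proof.
  revert j; apply pair_induction.
  - apply continuous_const.
  - apply (continuous_minus (fun _ => 1) (fun k : R => k));
      [apply continuous_const | apply continuous_id].
  - intros j IH0 IH1.
    apply (continuous_ext (fun k => plus (mult 2 (profile q k j))
             (mult (minus 1 (mult k (q ^ S j))) (profile q k (S j))))).
    { reflexivity. }
    apply (continuous_plus (K := R_AbsRing) (V := R_NormedModule)).
    + apply (continuous_mult (K := R_AbsRing)); [apply continuous_const | exact IH0].
    + apply (continuous_mult (K := R_AbsRing)); [| exact IH1].
      apply (continuous_minus (K := R_AbsRing) (V := R_NormedModule));
        [apply continuous_const |].
      apply (continuous_mult (K := R_AbsRing));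
        [apply continuous_id | apply continuous_const].
Qed.

Lemma open_settles (sg q : R) : open (settles sg q).
Proof.
  intros k [j [H0 H1]].
  assert (Hloc : forall i, 0 < sg * profile q k i ->
                 locally k (fun x => 0 < sg * profile q x i)).
  { intros i Hi.
    apply (continuous_mult (fun _ => sg) (fun x => profile q x i) k
             (continuous_const _ _) (continuous_profile q i k)
             (fun y => 0 < y)).
    apply open_gt; exact Hi. }
  generalize (filter_and _ _ (Hloc _ H0) (Hloc _ H1)).
  apply filter_imp; intros x Hx; exists j; exact Hx.
Qed.

(** The witness is the supremum [m] of [P] in [[a, b]]. If [m] were in [P], then [m < b] and
    openness would give points of [P] beyond [m]; if in [N], a left neighbourhood of [m] would miss
    [P]. *)
Lemma segment_connected (P N : R -> Prop) (a b : R) :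
  a <= b -> open P -> open N -> P a -> N b ->
  (forall x, a <= x <= b -> P x -> ~ N x) ->
  exists x, a <= x <= b /\ ~ P x /\ ~ N x.
Proof.
  intros Hab oP oN Pa Nb Hdisj.
  destruct (completeness (fun x => a <= x <= b /\ P x)) as [m [Hub Hlub]].
  { exists b; intros x Hx; lra. }
  { exists a; split; [lra | exact Pa]. }
  assert (Ham : a <= m) by (apply Hub; split; [lra | exact Pa]).
  assert (Hmb : m <= b) by (apply Hlub; intros x Hx; lra).
  exists m; split; [lra | split].
  - intros Pm.
    assert (Hne : m <> b) by (intros ->; exact (Hdisj b (conj Hab (Rle_refl b)) Pm Nb)).
    destruct (oP m Pm) as [d Hd].
    set (y := m + Rmin (d / 2) (b - m)).
    assert (Hd0 := cond_pos d).
    assert (Hm1 := Rmin_l (d / 2) (b - m)); assert (Hm2 := Rmin_r (d / 2) (b - m)).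
    assert (Hm3 : 0 < Rmin (d / 2) (b - m)) by (apply Rmin_pos; lra).
    assert (Hy : y <= m).
    { apply Hub; split; [unfold y; lra |].
      apply Hd; unfold y.
      change (Rabs (m + Rmin (d / 2) (b - m) - m) < d).
      rewrite Rabs_pos_eq; lra. }
    unfold y in Hy; lra.
  - intros Nm.
    destruct (oN m Nm) as [d Hd].
    assert (Hd0 := cond_pos d).
    assert (Hle : m <= m - d / 2); [| lra].
    apply Hlub; intros x [Hx Px].
    destruct (Rle_dec x (m - d / 2)) as [|Hn]; [assumption | exfalso].
    assert (Hxm : x <= m) by (apply Hub; split; assumption).
    apply (Hdisj x Hx Px), Hd.
    change (Rabs (x - m) < d).
    rewrite Rabs_minus_sym, Rabs_pos_eq; lra.
Qed.

Lemma profile_settles_negative (q : R) : 0 < q -> q ^ 3 = / 32 -> settles (-1) q (/ q).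
Proof.
  (* At [k = 1/q], with [q] about 0.315, the profile starts 1, -2.17, 2, -2.98, 1.32, -4.68, -2.01:
     indices 5 and 6 form the first pair of equal sign. *)
  intros Hq H3; exists 4%nat.
  assert (Hlo : 0.314 < q) by nra.
  assert (Hhi : q < 0.316) by nra.
  (* This makes both terms polynomials in [q]. *)
  assert (Hx : / q = 32 * q ^ 2).
  { apply (Rmult_eq_reg_l q); [| lra].
    rewrite Rinv_r by lra; lra. }
  assert (Hkq : forall j, / q * q ^ S j = q ^ j) by (intros j; simpl; field; lra).
  rewrite !profile_SS, !Hkq.
  simpl profile; rewrite Hx.
  simpl in *.
  split; nra.
Qed.

Lemma exists_alternating (q : R) :
  0 < q -> q ^ 3 = / 32 ->
  exists k, 0 < k /\
    forall j, profile q k (S j) * profile q k (S (S j)) <= 0.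
Proof.
  intros Hq H3.
  assert (Hq1 : q <= 1) by nra.
  assert (Hi := Rinv_0_lt_compat q Hq).
  assert (Hqi : / q * q = 1) by (apply Rinv_l; lra).
  assert (H0 : settles 1 q 0).
  { exists 0%nat; simpl; lra. }
  destruct (segment_connected (settles 1 q) (settles (-1) q) 0 (/ q))
    as [k [Hk [HP HN]]].
  - lra.
  - apply open_settles.
  - apply open_settles.
  - exact H0.
  - apply profile_settles_negative; assumption.
  - intros k Hk; apply settles_disjoint; nra.
  - exists k; split.
    + destruct (Req_dec k 0) as [->|]; [contradiction | lra].
    + intros j; apply Rnot_lt_le; intros Hpos.
      set (x := profile q k (S j)) in *; set (y := profile q k (S (S j))) in *.
      destruct (Rtotal_order x 0) as [Hx|[Hx|Hx]].
      * apply HN; exists j; fold x y; split; nra.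
      * rewrite Hx in Hpos; lra.
      * apply HP; exists j; fold x y; split; nra.
Qed.

(** * Boundedness of an alternating profile *)

Lemma Rabs_sub_opp_sign (x y : R) : x * y <= 0 -> Rabs (y - 2 * x) = 2 * Rabs x + Rabs y.
Proof.
  intros H; unfold Rabs.
  destruct (Rcase_abs (y - 2 * x)), (Rcase_abs x), (Rcase_abs y);
    apply Rle_antisym; nra.
Qed.

Lemma alternating_bounded (q k : R) :
  0 < q < 1 -> 0 < k ->
  (forall j, profile q k (S j) * profile q k (S (S j)) <= 0) ->
  exists B, forall j, Rabs (profile q k j) <= B.
Proof.
  intros Hq Hk Halt.
  set (e := profile q k) in *.
  (* The limiting recurrence has characteristic roots 2 and -1; this combination cancels the root
     2. *)
  set (G := fun j => Rabs (e (S (S j)) - 2 * e (S j))).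
  assert (Hstep : forall j, G (S j) <= G j * (1 + k * q ^ j)).
  { intros j; unfold G.
    replace (e (S (S (S j))) - 2 * e (S (S j))) with
      (- (e (S (S j)) - 2 * e (S j)) + - (k * q ^ S (S j)) * e (S (S j)))
      by (unfold e; rewrite (profile_SS q k (S j)); ring).
    eapply Rle_trans; [apply Rabs_triang |].
    rewrite Rabs_Ropp, Rabs_mult, Rabs_Ropp.
    assert (Hqj : 0 < q ^ j) by (apply pow_lt; lra).
    assert (Hle : 0 <= k * q ^ S (S j) <= k * q ^ j).
    { assert (Hq2 : 0 <= q * q <= 1) by nra.
      replace (q ^ S (S j)) with (q * q * q ^ j) by (simpl; ring).
      split; [apply Rmult_le_pos | apply Rmult_le_compat_l]; nra. }
    rewrite (Rabs_pos_eq (k * q ^ S (S j))) by lra.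
    rewrite (Rabs_sub_opp_sign _ _ (Halt j)).
    assert (H1 := Rabs_pos (e (S j))); assert (H2 := Rabs_pos (e (S (S j)))).
    nra. }
  (* The exponent is the sum of [k q^i] over [i < j], and [1 + x <= exp x] bounds each factor. *)
  assert (HG : forall j, G j <= G 0%nat * exp (k * (1 - q ^ j) / (1 - q))).
  { induction j as [|j IH].
    - replace (k * (1 - q ^ 0) / (1 - q)) with 0 by (simpl; field; lra).
      rewrite exp_0; lra.
    - eapply Rle_trans; [apply Hstep |].
      replace (k * (1 - q ^ S j) / (1 - q)) with
        (k * (1 - q ^ j) / (1 - q) + k * q ^ j) by (simpl; field; lra).
      rewrite exp_plus, <- Rmult_assoc.
      assert (Hqj : 0 < q ^ j) by (apply pow_lt; lra).
      apply Rmult_le_compat; [apply Rabs_pos | nra | exact IH |].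
      apply exp_ineq1_le. }
  exists (1 + G 0%nat * exp (k / (1 - q))).
  assert (HB : forall j, G j <= G 0%nat * exp (k / (1 - q))).
  { intros j; eapply Rle_trans; [apply HG |].
    apply Rmult_le_compat_l; [apply Rabs_pos |].
    apply Rlt_le, exp_increasing.
    apply Rmult_lt_compat_r; [ apply Rinv_0_lt_compat; lra |].
    assert (Hqj : 0 < q ^ j) by (apply pow_lt; lra).
    nra. }
  intros [|j].
  - assert (H0 := HB 0%nat).
    assert (H1 : 0 <= G 0%nat) by apply Rabs_pos.
    change (e 0%nat) with 1; rewrite Rabs_R1; lra.
  - assert (Hj := HB j); unfold G at 1 in Hj.
    rewrite (Rabs_sub_opp_sign _ _ (Halt j)) in Hj.
    assert (H1 := Rabs_pos (e (S j))); assert (H2 := Rabs_pos (e (S (S j)))); lra.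
Qed.

(** * From exponential solutions to the recurrence *)

Lemma lin_rhs_scal (lam x : R) (c : nat -> R) (j : nat) :
  lin_rhs lam (fun i => c i * x) j = lin_rhs lam c j * x.
Proof. destruct j; unfold lin_rhs; ring. Qed.

Lemma solves_exp_mode (lam mu : R) (c : nat -> R) :
  solves_lin lam (exp_mode c mu) <-> forall j, mu * c j = lin_rhs lam c j.
Proof.
  assert (D : forall j t, is_derive (exp_mode c mu j) t (mu * c j * exp (mu * t))).
  { intros j t; unfold exp_mode; auto_derive; [easy | ring]. }
  split.
  - intros H j.
    assert (E := is_derive_unique _ _ _ (H j 0)).
    rewrite (is_derive_unique _ _ _ (D j 0)) in E.
    unfold exp_mode in E; rewrite lin_rhs_scal, Rmult_0_r, exp_0 in E; lra.
  - intros H j t.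
    unfold exp_mode at 2; rewrite lin_rhs_scal, <- H; apply D.
Qed.

Lemma lin_rhs_cube_root (p : R) (c : nat -> R) (j : nat) :
  0 < p ->
  lin_rhs (p ^ 3) c j =
  match j with
  | O => - / p * c 0%nat - c 1%nat
  | S i => p ^ (2 * j) * (2 * / p ^ 2 * c i - / p * c j - c (S j))
  end.
Proof.
  intros Hp.
  assert (E : forall x, Rpower (p ^ 3) x = Rpower p (3 * x)).
  { intros x; rewrite <- (Rpower_pow 3 p Hp), Rpower_mult; f_equal; simpl; ring. }
  assert (E1 : Rpower (p ^ 3) (-1/3) = / p).
  { rewrite E; replace (3 * (-1/3)) with (- (1)) by field.
    rewrite Rpower_Ropp, Rpower_1; auto. }
  destruct j as [|i]; unfold lin_rhs; rewrite E1; [reflexivity |].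
  rewrite !E.
  replace (3 * (2 * INR (S i) / 3)) with (INR (2 * S i)) by (rewrite mult_INR; simpl; field).
  replace (3 * (-2/3)) with (- INR 2) by (simpl; field).
  rewrite Rpower_Ropp, !Rpower_pow by assumption; reflexivity.
Qed.

(** The powers of [-p] turn the eigenvalue equation into the recurrence of
    [profile], with [k = - p mu] and [q = p^-2]. *)
Lemma eigen_iff_profile (p mu : R) (c : nat -> R) :
  0 < p ->
  (forall j, mu * c j = lin_rhs (p ^ 3) c j) <->
  (forall j, (- p) ^ j * c j = c 0%nat * profile (/ p ^ 2) (- p * mu) j).
Proof.
  intros Hp; split; intros H.
  - intros j.
    rewrite <- (Rmult_1_l (c 0%nat)).
    apply (profile_unique (/ p ^ 2) (- p * mu) (fun j => (- p) ^ j * c j)).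
    + assert (H0 := H 0%nat); rewrite lin_rhs_cube_root in H0 by assumption.
      simpl.
      replace (c 1%nat) with (- / p * c 0%nat - mu * c 0%nat) by lra.
      field; lra.
    + clear j; intros j.
      assert (H1 := H (S j)); rewrite lin_rhs_cube_root in H1 by assumption.
      assert (Hpj : 0 < p ^ (2 * S j)) by (apply pow_lt; lra).
      replace (c (S (S j))) with
        (2 * / p ^ 2 * c j - / p * c (S j) - mu * c (S j) / p ^ (2 * S j))
        by (rewrite H1; field; lra).
      rewrite pow_inv, <- pow_mult.
      change ((- p) ^ S (S j)) with (- p * (- p * (- p) ^ j)).
      change ((- p) ^ S j) with (- p * (- p) ^ j).
      field; split; lra.
  - assert (Hc : forall j, c j = c 0%nat * profile (/ p ^ 2) (- p * mu) j / (- p) ^ j).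
    { intros j; rewrite <- H; field; apply pow_nonzero; lra. }
    intros [|j]; rewrite lin_rhs_cube_root by assumption.
    + rewrite (Hc 1%nat); simpl; field; lra.
    + rewrite (Hc j), (Hc (S j)), (Hc (S (S j))), profile_SS.
      assert (Hpj : 0 < p ^ (2 * S j)) by (apply pow_lt; lra).
      assert (Hmj : (- p) ^ j <> 0) by (apply pow_nonzero; lra).
      rewrite pow_inv, <- pow_mult.
      change ((- p) ^ S (S j)) with (- p * (- p * (- p) ^ j)).
      change ((- p) ^ S j) with (- p * (- p) ^ j).
      field; repeat split; lra.
Qed.

(** * Positive eigenvalues, Sobolev decay and the conclusion *)

Lemma no_positive_eigenvalue (p mu : R) :
  0 < p <= 2 -> 0 < mu -> ~ eigenvalue (p ^ 3) mu.
Proof.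
  intros Hp Hmu [c [[n Hn] [Hl2 Hsol]]].
  rewrite solves_exp_mode, eigen_iff_profile in Hsol by lra.
  assert (Hq : 0 < / p ^ 2) by (apply Rinv_0_lt_compat, pow_lt; lra).
  (* The recurrence determines the whole sequence from [c 0]. *)
  assert (Hc0 : c 0%nat <> 0).
  { intros E; specialize (Hsol n); rewrite E, Rmult_0_l in Hsol.
    apply Rmult_integral in Hsol; destruct Hsol as [Hsol|]; [| contradiction].
    revert Hsol; apply pow_nonzero; lra. }
  (* Here [p^j |c_j| = |c_0| e_j >= |c_0| 2^j / 2], and [p <= 2]. *)
  assert (Hlow : forall j, (c 0%nat / 2) ^ 2 <= c j ^ 2).
  { intros j.
    assert (Hprof : 2 ^ j / 2 <= profile (/ p ^ 2) (- p * mu) j)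
      by (apply profile_lower_bound; [exact Hq | nra]).
    assert (H2 : p ^ j <= 2 ^ j) by (apply pow_incr; lra).
    assert (Hpj : 0 < p ^ j) by (apply pow_lt; lra).
    rewrite <- !Rsqr_pow2; apply Rsqr_le_abs_1.
    unfold Rdiv; rewrite Rabs_mult, (Rabs_pos_eq (/ 2)) by lra.
    apply (Rmult_le_reg_l (p ^ j)); [assumption |].
    assert (E := f_equal Rabs (Hsol j)).
    rewrite !Rabs_mult, <- RPow_abs, Rabs_Ropp, (Rabs_pos_eq p) in E by lra.
    rewrite E, (Rabs_pos_eq (profile _ _ _)) by lra.
    assert (Ha := Rabs_pos (c 0%nat)).
    nra. }
  assert (Hlim := ex_series_lim_0 _ Hl2).
  assert (Hle := is_lim_seq_le _ _ _ _ Hlow (is_lim_seq_const _) Hlim).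
  simpl Rbar_le in Hle.
  assert (Hpos := pow2_gt_0 (c 0%nat / 2)); lra.
Qed.

(** The weighted squares are dominated by [B^2 x^j] with ratio [x = 2^(2(s-r)) < 1]. *)
Lemma in_Hs_decaying (s r B : R) (c : nat -> R) :
  s < r -> (forall j, Rpower 2 (r * INR j) * Rabs (c j) <= B) -> in_Hs s c.
Proof.
  intros Hs Hc.
  set (x := Rpower 2 (2 * (s - r))).
  assert (Hx : Rabs x < 1).
  { unfold x; rewrite Rabs_pos_eq by (left; apply exp_pos).
    rewrite <- (Rpower_O 2) by lra; apply Rpower_lt; lra. }
  apply (ex_series_le (K := R_AbsRing) (V := R_CompleteNormedModule)
           _ (fun j => B ^ 2 * x ^ j)).
  - intros j; change (Rabs (Rpower 2 (2 * s * INR j) * c j ^ 2) <= B ^ 2 * x ^ j).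
    assert (Hw : 0 < Rpower 2 (r * INR j)) by apply exp_pos.
    assert (Ex : Rpower 2 (2 * s * INR j) = x ^ j * Rpower 2 (r * INR j) ^ 2).
    { unfold x; rewrite <- !Rpower_pow by apply exp_pos.
      rewrite !Rpower_mult, <- Rpower_plus; f_equal; simpl; ring. }
    rewrite Rabs_mult, (Rabs_pos_eq (Rpower _ _)) by (left; apply exp_pos).
    rewrite Ex, <- RPow_abs, Rmult_assoc, <- Rpow_mult_distr, Rmult_comm.
    apply Rmult_le_compat_r.
    + apply pow_le; left; apply exp_pos.
    + apply pow_incr; split; [| apply Hc].
      apply Rmult_le_pos; [lra | apply Rabs_pos].
  - apply (ex_series_scal (K := R_AbsRing) (V := R_NormedModule) (B ^ 2)).
    exists (/ (1 - x)); apply is_series_geom; exact Hx.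
Qed.

Theorem lemma4p4 (lam : R) (hlam : lam = Rpower 2 (5/2)) :
  (forall mu : R, 0 < mu -> ~ eigenvalue lam mu) /\
  (exists (mu : R) (c : nat -> R),
     mu < 0 /\ nonzero_seq c /\ solves_lin lam (exp_mode c mu) /\
     (forall s : R, s < 5/6 -> in_Hs s c)).
Proof.
  (* The cube root of [lam]; [p^6 = 32] below yields [q^3 = 1/32]. *)
  set (p := Rpower 2 (5/6)).
  assert (Hp : 0 < p) by apply exp_pos.
  assert (Hpn : forall n, p ^ n = Rpower 2 (5/6 * INR n))
    by (intros n; unfold p; rewrite <- Rpower_pow, Rpower_mult by apply exp_pos; reflexivity).
  assert (Hlam : lam = p ^ 3) by (rewrite hlam, Hpn; f_equal; simpl; field).
  assert (H2 : p <= 2).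
  { rewrite <- (Rpower_1 2) by lra; apply Rle_Rpower; lra. }
  assert (H6 : p ^ 6 = 32).
  { rewrite Hpn; replace (5/6 * INR 6) with (INR 5) by (simpl; field).
    rewrite Rpower_pow by lra; simpl; lra. }
  rewrite Hlam; split.
  - intros mu Hmu; apply no_positive_eigenvalue; lra.
  - set (q := / p ^ 2).
    assert (Hq : 0 < q) by (apply Rinv_0_lt_compat, pow_lt; lra).
    assert (Hq3 : q ^ 3 = / 32).
    { unfold q; rewrite pow_inv, <- pow_mult; simpl (2 * 3)%nat; rewrite H6; reflexivity. }
    assert (Hq1 : q < 1) by nra.
    destruct (exists_alternating q Hq Hq3) as [k [Hk Halt]].
    destruct (alternating_bounded q k) as [B HB]; [lra | lra | exact Halt |].
    assert (Hpj : forall j, (- p) ^ j <> 0) by (intros j; apply pow_nonzero; lra).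
    exists (- k / p), (fun j => profile q k j / (- p) ^ j).
    split; [| split; [| split]].
    + assert (0 < k / p) by (apply Rdiv_lt_0_compat; lra).
      unfold Rdiv in *; lra.
    + exists 0%nat; simpl; lra.
    + apply solves_exp_mode, eigen_iff_profile; [exact Hp |].
      intros j; replace (- p * (- k / p)) with k by (field; lra).
      fold q; simpl (profile q k 0 / _); field.
      apply Hpj.
    (* The exponent 5/6 arises because [2^(5j/6) |c_j| = p^j |c_j| = |e_j| <= B]. *)
    + intros s Hs; apply (in_Hs_decaying s (5/6) B); [exact Hs |].
      intros j; rewrite <- Hpn, Rabs_div by apply Hpj.
      rewrite <- RPow_abs, Rabs_Ropp, (Rabs_pos_eq p) by lra.
      assert (Hj : p ^ j <> 0) by (apply pow_nonzero; lra).
      replace (p ^ j * (Rabs (profile q k j) / p ^ j)) with (Rabs (profile q k j))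
        by (field; exact Hj).
      apply HB.
Qed.
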